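(* Let $G=(V,E)$ be a distance-regular graph with classical parameters $(D,b,\alpha,\beta)$ of diameter $D=3$. Then $G$ has the monotonic normalized heat diffusion (MNHD) property: for any two distinct vertices $u,v\in V$, the function $t\mapsto r_t(u,v):=\frac{H_t(u,v)}{H_t(u,u)}$ is monotonically non-decreasing on $[0,\infty)$.
   Context: All graphs are simple, finite and connected. For a graph $G=(V,E)$, $A$ is the adjacency matrix, $\mathrm{Deg}$ the diagonal degree matrix, $L=\mathrm{Deg}-A$ the graph Laplacian, and $H_t=e^{-tL}$ ($t\ge 0$) the heat kernel, with entries $H_t(u,v)$. A connected graph of diameter $D$ is distance-regular if it is $d$-regular and there are constants $b_i,c_i$ such that for any vertices $x,y$ at distance $i$, among the neighbours of $y$ exactly $c_i$ are at distance $i-1$ from $x$ and $b_i$ are at distance $i+1$ from $x$. It has classical parameters $(D,b,\alpha,\beta)$ if $b_i=\left(\begin{bmatrix}D\\1\end{bmatrix}-\begin{bmatrix}i\\1\end{bmatrix}\right)\left(\beta-\alpha\begin{bmatrix}i\\1\end{bmatrix}\right)$ for $0\le i\le D-1$ and $c_i=\begin{bmatrix}i\\1\end{bmatrix}\left(1+\alpha\begin{bmatrix}i-1\\1\end{bmatrix}\right)$ for $1\le i\le D$, where $\begin{bmatrix}j\\1\end{bmatrix}=1+b+\dots+b^{j-1}$. (It is known that $b$ must be an integer different from $0$ and $-1$.) *)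

(* Defs.v *)
From mathcomp Require Import all_boot all_order all_algebra.
From mathcomp Require Import all_classical all_reals all_analysis.

Set Implicit Arguments.
Unset Strict Implicit.
Unset Printing Implicit Defensive.

Import Order.TTheory GRing.Theory Num.Theory.
Import numFieldNormedType.Exports.

Local Open Scope ring_scope.

Record is_connected_graph (V : finType) (e : rel V) : Prop := IsConnectedGraph {
  graph_sym : symmetric e;
  graph_irr : irreflexive e;
  graph_conn : forall x y : V, connect e x y }.

Section Distance.
Variables (V : finType) (e : rel V).

Definition walk (n : nat) (x y : V) : bool :=
  [exists p : n.-tuple V, path e x p && (last x p == y)].

(* A shortest walk visits each vertex at most once, so searching the lengths
   0, ..., #|V| - 1 suffices; [gdist x y = #|V|] when [y] is not reachable. *)
Definition gdist (x y : V) : nat :=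
  find (fun n => walk n x y) (iota 0 #|V|).

Definition diameter : nat := \max_(x : V) \max_(y : V) gdist x y.

Definition degree (x : V) : nat := #|[set y | e x y]|.

(* The distances are compared through successors so that for [x = y] the
   count by [cs] is empty, rather than affected by the truncated [0.-1 = 0]. *)
Record has_intersection_numbers (d : nat) (bs cs : nat -> nat) : Prop :=
  HasIntersectionNumbers {
    drg_regular : forall x : V, degree x = d;
    drg_b : forall x y : V,
      #|[set z | e y z & gdist x z == (gdist x y).+1]| = bs (gdist x y);
    drg_c : forall x y : V,
      #|[set z | e y z & (gdist x z).+1 == gdist x y]| = cs (gdist x y) }.

End Distance.

Definition bracket (R : pzRingType) (b : R) (j : nat) : R :=
  \sum_(k < j) b ^+ k.

(* [b] is an arbitrary real: that it is an integer other than 0 and -1 follows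
   from these equations when [D >= 3]. *)
Record has_classical_parameters (R : realType) (V : finType) (e : rel V)
    (D : nat) (b alpha beta : R) : Prop := HasClassicalParameters {
  classical_diameter : diameter e = D;
  classical_drg : exists (d : nat) (bs cs : nat -> nat),
    [/\ has_intersection_numbers e d bs cs,
        forall i, (i < D)%N ->
          (bs i)%:R = (bracket b D - bracket b i)
                      * (beta - alpha * bracket b i)
      & forall i, (1 <= i <= D)%N ->
          (cs i)%:R = bracket b i * (1 + alpha * bracket b i.-1)] }.

Section HeatKernel.
Variable R : realType.

Definition expmx (n : nat) (A : 'M[R]_n) : 'M[R]_n :=
  limn (series (fun k : nat => k`!%:R^-1 *: A ^+ k)).

Variables (V : finType) (e : rel V).

Definition adjmx : 'M[R]_#|V| :=
  \matrix_(i, j) (e (enum_val i) (enum_val j))%:R.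

Definition degmx : 'M[R]_#|V| :=
  diag_mx (\row_i (degree e (enum_val i))%:R).

Definition laplacian : 'M[R]_#|V| := degmx - adjmx.

Definition heat_kernel (t : R) (u v : V) : R :=
  expmx (- t *: laplacian) (enum_rank u) (enum_rank v).

Definition heat_ratio (u v : V) (t : R) : R :=
  heat_kernel t u v / heat_kernel t u u.

Definition MNHD : Prop :=
  forall u v : V, u != v ->
    {in `[0, +oo[ &, {homo heat_ratio u v : s t / s <= t}}.

End HeatKernel.

(* Main.v *)
(* Write [h i t] for the entry of [exp (t (K - L))] at two vertices at distance
   [i]; the shift by [K] cancels in the heat ratios. The sign of the derivative
   of [h i / h 0] is that of [w i = h i' h 0 - h i h 0'], and the intersection
   numbers express [h i'] through [h (i - 1)], [h i], [h (i + 1)].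

   For large [K] the recurrence for the entries of the powers of [K - L]
   preserves nonnegative sequences that are nonincreasing in the distance, so
   [h 0 >= h 1 >= h 2 >= h 3 >= 0], and
   [w 3 = c_3 (h 2 - h 3) h 0 + b_0 (h 0 - h 1) h 3] is nonnegative.
   Next [b_0 w 1 = W], where [W = h 0 h 0'' - h 0' ^ 2 >= 0] by Cauchy-Schwarz.
   Finally [F = b_0 b_1 w 2] equals [W' - c W] for a constant [c]; it vanishes at
   [0], and [F' - c F = W'' - 2 c W' + c ^ 2 W >= 0], again by Cauchy-Schwarz. *)
Require Import Defs.
From mathcomp Require Import all_boot all_order all_algebra.
From mathcomp Require Import all_classical all_reals all_analysis.
From mathcomp Require Import ring lra.

Set Implicit Arguments.
Unset Strict Implicit.
Unset Printing Implicit Defensive.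

Import Order.TTheory GRing.Theory Num.Theory.
Import numFieldNormedType.Exports.

Local Open Scope classical_set_scope.
Local Open Scope ring_scope.

(** * Entrywise convergence of matrices *)

Lemma cvg_mxP (R : realType) m p (F : set_system 'M[R]_(m, p)) {FF : Filter F}
    (l : 'M[R]_(m, p)) :
  F --> l <-> forall i j, (fun M : 'M[R]_(m, p) => M i j) @ F --> l i j.
Proof.
split=> [Fl i j U Uij|Fl U [Q lQ QU]].
  apply: Fl; exists (fun i' j' => if (i' == i) && (j' == j) then U else setT).
    by move=> i' j' /=; case: ifP => [/andP[/eqP-> /eqP->]//|_]; exact: filterT.
  by move=> M /(_ i j); rewrite !eqxx.
apply: filterS QU _.
apply: filter_forall => i; apply: filter_forall => j.
exact: (Fl i j (Q i j) (lQ i j)).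
Qed.

(** * The matrix exponential *)

Section MatrixExponential.
Variables (R : realType) (n : nat).
Implicit Types (A P : 'M[R]_n) (i j : 'I_n) (t : R).

(** The sum of all absolute entries dominates every absolute row sum. This crude bound suffices to
    dominate each entry of the exponential series by a real exponential series. *)
Lemma norm_mx_exprn_le A k i j :
  `|(A ^+ k) i j| <= (\sum_a \sum_b `|A a b|) ^+ k.
Proof.
elim: k i j => [|k IHk] i j.
  by rewrite !expr0 mxE; case: (i == j); rewrite ?normr1// normr0 ler01.
rewrite !exprS -mulmxE mxE (le_trans (ler_norm_sum _ _ _))//.
apply: (@le_trans _ _ (\sum_b `|A i b| * (\sum_a \sum_b `|A a b|) ^+ k)).
  by apply: ler_sum => b _; rewrite normrM ler_wpM2l.
rewrite -mulr_suml ler_wpM2r ?exprn_ge0 ?sumr_ge0//.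
  by move=> a _; rewrite sumr_ge0.
rewrite [leRHS](bigD1 i)//= lerDl sumr_ge0// => a _.
by rewrite sumr_ge0.
Qed.

Definition expmx_coef A i j (k : nat) : R := (A ^+ k) i j / k`!%:R.

Lemma is_cvg_expmx_coef A i j t : cvgn (pseries (expmx_coef A i j) t).
Proof.
apply: normed_cvg.
set s := \sum_a \sum_b `|A a b|.
apply: (@series_le_cvg _ _ (exp_coeff (s * `|t|))) => [k|k|k|] //=.
- by rewrite exp_coeff_ge0// mulr_ge0// sumr_ge0// => a _; rewrite sumr_ge0.
- rewrite /expmx_coef !normrM normrX normfV (ger0_norm (ler0n _ _)) /exp_coeff/= exprMn.
  rewrite mulrAC ler_wpM2r ?invr_ge0// ler_wpM2r ?exprn_ge0//.
  exact: norm_mx_exprn_le.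
- exact: is_cvg_series_exp_coeff.
Qed.

Lemma exprZmx A t k : (t *: A) ^+ k = t ^+ k *: A ^+ k.
Proof.
elim: k => [|k IHk]; first by rewrite !expr0 scale1r.
by rewrite !exprS IHk -mulmxE -scalemxAl -scalemxAr scalerA.
Qed.

Definition expmx_series A t : nat -> 'M[R]_n :=
  series (fun k : nat => k`!%:R^-1 *: (t *: A) ^+ k).

Lemma expmx_seriesE A t m i j :
  expmx_series A t m i j = pseries (expmx_coef A i j) t m.
Proof.
rewrite /expmx_series /pseries /series/= summxE; apply: eq_bigr => k _.
by rewrite exprZmx !mxE /expmx_coef; ring.
Qed.

Lemma cvg_expmx A t : expmx_series A t @ \oo --> expmx (t *: A).
Proof.
suff cv : cvgn (expmx_series A t) by exact: cv.
apply/cvg_ex; exists (\matrix_(i, j) limn (pseries (expmx_coef A i j) t)).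
apply/cvg_mxP => i j; rewrite mxE.
suff : expmx_series A t m i j @[m --> \oo] -->
    limn (pseries (expmx_coef A i j) t) by [].
by under eq_fun do rewrite expmx_seriesE; exact: is_cvg_expmx_coef.
Qed.

Lemma cvg_expmx_coord A t i j :
  expmx_series A t m i j @[m --> \oo] --> expmx (t *: A) i j.
Proof.
exact: (iffLR (cvg_mxP (F := expmx_series A t @ \oo) _) (@cvg_expmx A t) i j).
Qed.

Lemma expmxE A t i j : expmx (t *: A) i j = limn (pseries (expmx_coef A i j) t).
Proof.
apply/esym/cvg_lim => //; have := @cvg_expmx_coord A t i j.
by under eq_fun do rewrite expmx_seriesE.
Qed.

Lemma cvg_mulmx_expmx A P t i j :
  (P *m expmx_series A t m) i j @[m --> \oo] --> (P *m expmx (t *: A)) i j.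
Proof.
rewrite mxE; under eq_fun do rewrite mxE.
apply: cvg_big => [|l _]; first exact: add_continuous.
by apply: cvgMl_tmp; exact: cvg_expmx_coord.
Qed.

Lemma cvg_mulmxr_expmx A P t i j :
  (expmx_series A t m *m P) i j @[m --> \oo] --> (expmx (t *: A) *m P) i j.
Proof.
rewrite mxE; under eq_fun do rewrite mxE.
apply: cvg_big => [|l _]; first exact: add_continuous.
by apply: cvgMr_tmp; exact: cvg_expmx_coord.
Qed.

Lemma expmx_comm A t : A *m expmx (t *: A) = expmx (t *: A) *m A.
Proof.
apply/matrixP => i j; apply: (cvg_unique _ (@cvg_mulmx_expmx A A t i j)) => //.
rewrite (_ : (fun m => _) = fun m => (expmx_series A t m *m A) i j).
  exact: cvg_mulmxr_expmx.
apply/funext => m; congr (fun_of_matrix _ i j).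
rewrite /expmx_series /series/= mulmx_suml mulmx_sumr; apply: eq_bigr => k _.
rewrite exprZmx -!scalemxAl -!scalemxAr; do 2 congr (_ *: _).
by rewrite mulmxE -exprS -exprSr.
Qed.

(** The left factor [P] closes the family under formal differentiation, which merely replaces [P] by
    [P *m A]. *)
Lemma pseries_diffs_expmx_coef A P i j :
  pseries_diffs (fun k => (P *m A ^+ k) i j / k`!%:R) =
  (fun k => (P *m A *m A ^+ k) i j / k`!%:R).
Proof.
apply/funext => k; rewrite /pseries_diffs -mulmxA -[A *m A ^+ k]/(A * A ^+ k) -exprS.
by rewrite factS natrM invfM mulrCA mulVKf// pnatr_eq0.
Qed.

Lemma pseries_mulmxE A P t i j :
  pseries (fun k => (P *m A ^+ k) i j / k`!%:R) t =
  fun m => (P *m expmx_series A t m) i j.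
Proof.
apply/funext => m; rewrite /pseries /expmx_series /series/= mulmx_sumr summxE.
by apply: eq_bigr => k _; rewrite exprZmx -!scalemxAr !mxE; ring.
Qed.

Lemma is_derive_expmx A t i j :
  is_derive t (1 : R) (fun t => expmx (t *: A) i j) ((A *m expmx (t *: A)) i j).
Proof.
have cvgP P x :
    pseries (fun k => (P *m A ^+ k) i j / k`!%:R) x @ \oo -->
    (P *m expmx (x *: A)) i j.
  by rewrite pseries_mulmxE; exact: cvg_mulmx_expmx.
rewrite (_ : (fun t => _) =
    fun t => limn (pseries (fun k => (1%:M *m A ^+ k) i j / k`!%:R) t)); last first.
  by apply/funext => x; apply/esym/cvg_lim => //; have := cvgP 1%:M x; rewrite mul1mx.
rewrite (_ : (A *m _) i j =
    limn (pseries (pseries_diffs (fun k => (1%:M *m A ^+ k) i j / k`!%:R)) t)); last first.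
  by apply/esym/cvg_lim => //; rewrite pseries_diffs_expmx_coef mul1mx; exact: cvgP.
(* Termwise differentiation at [t] requires the series and its first two formal derivatives to
   converge at a point of larger modulus; [|t| + 1] is one. *)
apply: (@pseries_snd_diffs _ _ (`|t| + 1)); rewrite ?pseries_diffs_expmx_coef.
- by apply/cvg_ex; eexists; exact: cvgP.
- by apply/cvg_ex; eexists; exact: cvgP.
- by apply/cvg_ex; eexists; exact: cvgP.
- by rewrite [ltRHS]ger0_norm// ltrDl.
Qed.

Lemma lim_pseries0 (c : R^nat) : limn (pseries c 0) = c 0%N.
Proof.
apply: lim_near_cst => //; exists 1%N => // -[|m]// _.
rewrite /pseries /series/= big_nat_recl//= expr0 mulr1 big1 ?addr0// => k _.
by rewrite expr0n mulr0.
Qed.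

Lemma expmx0 : expmx (0 : 'M[R]_n) = 1%:M.
Proof.
apply/matrixP => i j; rewrite -(scale0r 0) expmxE lim_pseries0.
by rewrite /expmx_coef expr0 fact0 divr1.
Qed.

Lemma is_derive_mx_mul (F G : R -> 'M[R]_n) (dF dG : 'M[R]_n) t i j :
  (forall l, is_derive t (1 : R) (fun t => F t i l) (dF i l)) ->
  (forall l, is_derive t (1 : R) (fun t => G t l j) (dG l j)) ->
  is_derive t (1 : R) (fun t => (F t *m G t) i j)
    ((dF *m G t + F t *m dG) i j).
Proof.
move=> hF hG.
rewrite (_ : (fun _ => _) =
    \sum_(l < n) ((fun t => F t i l) * (fun t => G t l j) : R -> R)); last first.
  by apply/funext => x; rewrite mxE fct_sumE.
apply: is_derive_eq.
rewrite !mxE -big_split/=; apply: eq_bigr => l _.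
by rewrite addrC; congr (_ + _); exact: mulrC.
Qed.

Lemma is_derive_mulmx_expmx A P t i j :
  is_derive t (1 : R) (fun t => (P *m expmx (t *: A)) i j)
    ((P *m A *m expmx (t *: A)) i j).
Proof.
apply: is_derive_eq.
  apply: (@is_derive_mx_mul (fun=> P) _ 0) => l; last exact: is_derive_expmx.
  by rewrite mxE; exact: is_derive_cst.
by rewrite mul0mx add0r mulmxA.
Qed.

(** The product [Z s] of exp((t - s) A) and [Y s] has zero derivative, because [A] commutes with its
    exponential; its values at [t] and [0] are the two sides. The addition, transpose and
    scalar-shift rules below follow by checking the differential equation and the initial value. *)
Lemma expmx_ode_unique A (Y : R -> 'M[R]_n) :
  (forall t i j, is_derive t (1 : R) (fun t => Y t i j) ((A *m Y t) i j)) ->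
  forall t, Y t = expmx (t *: A) *m Y 0.
Proof.
move=> dY t; apply/matrixP => i j.
pose Z (s : R) : R := (expmx ((t - s) *: A) *m Y s) i j.
have -> : Y t i j = Z t by rewrite /Z subrr scale0r expmx0 mul1mx.
rewrite -[in RHS](subr0 t) -[RHS]/(Z 0).
apply: is_derive_0_is_cst => s; apply: is_derive_eq.
  apply: (@is_derive_mx_mul (fun s => expmx ((t - s) *: A)) Y
    (- (A *m expmx ((t - s) *: A))) (A *m Y s)) => l.
  have dts : is_derive s (1 : R) (fun s => t - s) (-1).
    by apply: is_derive_eq; rewrite add0r mul1r.
  have := @is_derive1_comp R (fun x => expmx (x *: A) i l) (fun s => t - s) _ _ _
    (@is_derive_expmx A (t - s) i l) dts.
  rewrite mulrN1 (_ : (- (A *m expmx ((t - s) *: A))) i l =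
    - (A *m expmx ((t - s) *: A)) i l) //; by rewrite mxE.
by rewrite mulNmx expmx_comm mulmxA addNr mxE.
Qed.

Lemma expmx_unique A (Y : R -> 'M[R]_n) :
  (forall t i j, is_derive t (1 : R) (fun t => Y t i j) ((A *m Y t) i j)) ->
  Y 0 = 1%:M -> forall t, Y t = expmx (t *: A).
Proof. by move=> dY Y0 t; rewrite (expmx_ode_unique dY) Y0 mulmx1. Qed.

Lemma expmxD A s t :
  expmx ((s + t) *: A) = expmx (s *: A) *m expmx (t *: A).
Proof.
have := @expmx_ode_unique A (fun s => expmx ((s + t) *: A)).
move=> /(_ _ s); rewrite add0r; apply => {s} s i j.
have ds : is_derive s (1 : R) (fun s => s + t) 1.
  by apply: is_derive_eq; rewrite addr0.
by have := @is_derive1_comp R (fun x => expmx (x *: A) i j) (fun s => s + t) _ _ _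
    (@is_derive_expmx A (s + t) i j) ds; rewrite mulr1.
Qed.

Lemma expmx_tr A t : (expmx (t *: A))^T = expmx (t *: A^T).
Proof.
apply: (@expmx_unique A^T (fun t => (expmx (t *: A))^T)) => [{}t i j|].
  rewrite -trmx_mul -expmx_comm.
  under eq_fun do rewrite mxE.
  by rewrite mxE; exact: is_derive_expmx.
by rewrite scale0r expmx0 trmx1.
Qed.

Lemma expmx_addscalar A c t :
  expmx (t *: (A + c%:M)) = expR (c * t) *: expmx (t *: A).
Proof.
apply/esym.
apply: (@expmx_unique (A + c%:M) (fun t => expR (c * t) *: expmx (t *: A))).
  move=> {}t i j.
  have dc : is_derive t (1 : R) (fun t => c * t) c.
    by have := is_deriveZ c (is_derive_id t (1 : R)); rewrite [_ *: 1]mulr1.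
  have de := @is_derive1_comp R expR (fun t => c * t) _ _ _
    (is_derive_expR (c * t)) dc.
  rewrite (_ : (fun _ => _) =
    (expR \o (fun t => c * t)) * (fun t => expmx (t *: A) i j)); last first.
    by apply/funext => x; rewrite mxE.
  apply: is_derive_eq; first exact: is_deriveM de (@is_derive_expmx A t i j).
  rewrite mulmxDl mul_scalar_mx -!scalemxAr !mxE /= /GRing.scale/=.
  by ring.
by rewrite mulr0 expR0 scale0r expmx0 scale1r.
Qed.

End MatrixExponential.

(** * Cauchy-Schwarz and moments of the exponential *)

Lemma cauchy_schwarz_sum (R : realFieldType) (I : finType) (x y : I -> R) :
  (\sum_i x i * y i) ^+ 2 <= (\sum_i x i ^+ 2) * (\sum_i y i ^+ 2).
Proof.
set a := \sum_i x i ^+ 2; set b := \sum_i x i * y i.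
have a0 : 0 <= a by apply: sumr_ge0 => i _; exact: sqr_ge0.
move: (a0); rewrite le_eqVlt => /predU1P[/esym/eqP|a_gt0].
  rewrite psumr_eq0 => [/allP x0|i _]; last exact: sqr_ge0.
  rewrite {1}/b big1 ?expr0n ?mulr_ge0// => [|i _].
    by apply: sumr_ge0 => i _; exact: sqr_ge0.
  by move: (x0 i); rewrite mem_index_enum sqrf_eq0 => /(_ isT)/eqP->; rewrite mul0r.
(* This sum of squares is [a] times the defect of the inequality, so it settles the case [a > 0]. *)
have : 0 <= \sum_i (a * y i - b * x i) ^+ 2.
  by apply: sumr_ge0 => i _; exact: sqr_ge0.
have expand p q : \sum_i (p * y i - q * x i) ^+ 2 =
    p ^+ 2 * (\sum_i y i ^+ 2) - (p * q *+ 2) * (\sum_i x i * y i) +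
    q ^+ 2 * (\sum_i x i ^+ 2).
  rewrite !mulr_sumr -sumrB -big_split/=; apply: eq_bigr => i _.
  by ring.
rewrite expand -/a -/b (_ : _ + _ = a * (a * (\sum_i y i ^+ 2) - b ^+ 2)); last by ring.
by rewrite pmulr_rge0// subr_ge0.
Qed.


Section ExponentialMoments.
Variables (R : realType) (n : nat) (A : 'M[R]_n) (u : 'I_n).
Hypothesis A_sym : A^T = A.

(** The [k]-th derivative of the diagonal entry of exp(tA) at [u]. For symmetric [A] it is the
    [k]-th moment of the spectral measure at [u], weighted by the exponential. *)
Definition exp_moment k t : R := (A ^+ k *m expmx (t *: A)) u u.

Lemma is_derive_exp_moment k t :
  is_derive t (1 : R) (exp_moment k) (exp_moment k.+1 t).
Proof.
have -> : exp_moment k.+1 t = (A ^+ k *m A *m expmx (t *: A)) u u.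
  by rewrite /exp_moment exprSr.
exact: is_derive_mulmx_expmx.
Qed.

Lemma trmx_exprn k : (A ^+ k)^T = A ^+ k.
Proof.
elim: k => [|k IHk]; first by rewrite expr0 trmx1.
by rewrite exprS -mulmxE trmx_mul IHk A_sym mulmxE -exprSr exprS.
Qed.

Lemma exprn_expmx_comm k t : A ^+ k *m expmx (t *: A) = expmx (t *: A) *m A ^+ k.
Proof.
elim: k => [|k IHk]; first by rewrite expr0 mulmx1 mul1mx.
by rewrite exprS -mulmxE -mulmxA IHk mulmxA expmx_comm -mulmxA.
Qed.

Lemma trmx_exprn_expmx k t :
  (A ^+ k *m expmx (t *: A))^T = A ^+ k *m expmx (t *: A).
Proof. by rewrite trmx_mul expmx_tr trmx_exprn A_sym exprn_expmx_comm. Qed.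

(** Splitting exp(tA) into two symmetric factors exp(tA/2) turns a moment into an inner product of
    rows, so the moments form a Gram matrix. *)
Lemma exp_momentD j k t :
  exp_moment (j + k) t =
  \sum_w (A ^+ j *m expmx ((t / 2) *: A)) u w * (A ^+ k *m expmx ((t / 2) *: A)) u w.
Proof.
rewrite /exp_moment {1}(splitr t) expmxD exprD -mulmxE -mulmxA.
rewrite (mulmxA (A ^+ k)) exprn_expmx_comm -mulmxA mulmxA mxE.
apply: eq_bigr => w _; congr (_ * _).
by rewrite -exprn_expmx_comm -[in RHS]trmx_exprn_expmx [RHS]mxE.
Qed.

Lemma exp_moment_log_convex t :
  exp_moment 1 t ^+ 2 <= exp_moment 0 t * exp_moment 2 t.
Proof.
rewrite (exp_momentD 0 1) (exp_momentD 0 0) (exp_momentD 1 1).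
exact: cauchy_schwarz_sum.
Qed.

(** Cauchy-Schwarz for the rows at [u] of exp(tA/2) and (A^2 - cA) exp(tA/2). *)
Lemma exp_moment_shifted_cauchy_schwarz c t :
  (exp_moment 2 t - c * exp_moment 1 t) ^+ 2 <=
  exp_moment 0 t *
  (exp_moment 4 t - c * exp_moment 3 t *+ 2 + c ^+ 2 * exp_moment 2 t).
Proof.
pose x k w := (A ^+ k *m expmx ((t / 2) *: A)) u w.
have := cauchy_schwarz_sum (x 0%N) (fun w => x 2%N w - c * x 1%N w).
rewrite (_ : \sum_w _ = exp_moment 2 t - c * exp_moment 1 t); last first.
  rewrite (exp_momentD 0 2) (exp_momentD 0 1) mulr_sumr -sumrB.
  by apply: eq_bigr => w _; rewrite -/(x 0%N w) -/(x 1%N w) -/(x 2%N w); ring.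
rewrite (_ : \sum_w x 0%N w ^+ 2 = exp_moment 0 t); last first.
  by rewrite (exp_momentD 0 0).
rewrite (_ : \sum_w _ =
  exp_moment 4 t - c * exp_moment 3 t *+ 2 + c ^+ 2 * exp_moment 2 t) //.
rewrite (exp_momentD 2 2) (exp_momentD 2 1) (exp_momentD 1 1).
rewrite -mulrnAr -sumrMnl !mulr_sumr -sumrB -big_split/=.
by apply: eq_bigr => w _; rewrite -/(x 1%N w) -/(x 2%N w); ring.
Qed.

End ExponentialMoments.

(** * Monotonicity from derivatives *)

Lemma is_derive_ge0_le (R : realType) (f f' : R -> R) (s t : R) :
  (forall x : R, 0 <= x -> is_derive x (1 : R) f (f' x)) ->
  (forall x : R, 0 <= x -> 0 <= f' x) ->
  0 <= s -> s <= t -> f s <= f t.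
Proof.
move=> df f'0 s0 st.
have cf : {within `[0, +oo[, continuous f}.
  apply: derivable_within_continuous => x; rewrite in_itv/= andbT => x0.
  by have [] := df x x0.
apply: (@ger0_derive1_ndecry R f 0) => // x; rewrite in_itv/= andbT => /ltW x0.
  by have [] := df x x0.
by have [_] := df x x0; rewrite derive1E => ->; exact: f'0.
Qed.

Lemma ratio_homo (R : realType) (f g f' g' : R -> R) (s t : R) :
  (forall x : R, 0 <= x -> is_derive x (1 : R) f (f' x)) ->
  (forall x : R, 0 <= x -> is_derive x (1 : R) g (g' x)) ->
  (forall x : R, 0 <= x -> 0 < g x) ->
  (forall x : R, 0 <= x -> 0 <= f' x * g x - f x * g' x) ->
  0 <= s -> s <= t -> f s / g s <= f t / g t.
Proof.
move=> df dg g0 w0.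
apply: (@is_derive_ge0_le R (fun x => f x / g x)
  (fun x => (f' x * g x - f x * g' x) / g x ^+ 2)) => x x0; last first.
  by rewrite divr_ge0 ?w0 ?sqr_ge0.
have gN0 : g x != 0 by rewrite gt_eqF// g0.
have dgV := is_deriveV gN0 (dg x x0).
apply: is_derive_eq; first exact: is_deriveM (df x x0) dgV.
rewrite /GRing.scale/=.
by field.
Qed.

(* With [W = m0 m2 - m1 ^ 2] this is [F = W' - c W], and
   [F' - c F = W'' - 2 c W' + c ^ 2 W] is a Gram determinant. *)
Lemma exp_moment_third_order (R : realType) (n : nat) (A : 'M[R]_n) (u : 'I_n)
    (c : R) (F := fun t : R => exp_moment A u 3 t * exp_moment A u 0 t
      - exp_moment A u 2 t * exp_moment A u 1 t
      - c * (exp_moment A u 2 t * exp_moment A u 0 t - exp_moment A u 1 t ^+ 2)) :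
  A^T = A -> F 0 = 0 -> forall t : R, 0 <= t -> 0 <= F t.
Proof.
move=> A_sym F0 t t0.
(* The integrating factor exp(-ct) turns nonnegativity of F' - cF into monotonicity. *)
suff : expR (- c * 0) * F 0 <= expR (- c * t) * F t.
  by rewrite F0 mulr0 pmulr_rge0// expR_gt0.
apply: (@is_derive_ge0_le R (fun t : R => expR (- c * t) * F t)
  (fun t : R => expR (- c * t) *
   (exp_moment A u 0 t * (exp_moment A u 4 t - c * exp_moment A u 3 t *+ 2
      + c ^+ 2 * exp_moment A u 2 t)
    - (exp_moment A u 2 t - c * exp_moment A u 1 t) ^+ 2))) => // x _; last first.
  by rewrite mulr_ge0 ?expR_ge0// subr_ge0 exp_moment_shifted_cauchy_schwarz.
have dm k := @is_derive_exp_moment R n A u k x.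
have dc : is_derive x (1 : R) (fun t => - c * t) (- c).
  by have := is_deriveZ (- c) (is_derive_id x (1 : R)); rewrite [_ *: 1]mulr1.
have de := @is_derive1_comp R expR (fun t => - c * t) _ _ _
  (is_derive_expR (- c * x)) dc.
have -> : (fun t : R => expR (- c * t) * F t) =
    (expR \o (fun t => - c * t)) *
    (exp_moment A u 3 * exp_moment A u 0 - exp_moment A u 2 * exp_moment A u 1
     - c \*: (exp_moment A u 2 * exp_moment A u 0
              - exp_moment A u 1 * exp_moment A u 1)).
  by apply/funext => y; rewrite /F expr2.
apply: is_derive_eq.
rewrite !fctE /= /GRing.scale/=.
by ring.
Qed.

(** * Distance-regular graphs *)

Section GraphDistance.
Variables (V : finType) (e : rel V).

Lemma walkP k x y :
  reflect (exists p, [/\ size p = k, path e x p & last x p = y]) (walk e k x y).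
Proof.
apply: (iffP existsP) => [[p /andP[ep /eqP lp]]|[p [sp ep lp]]].
  by exists p; rewrite size_tuple.
by exists (Tuple (introT eqP sp)); rewrite /= ep lp eqxx.
Qed.

Lemma gdist_le_walk k x y : walk e k x y -> (gdist e x y < #|V|)%N ->
  (gdist e x y <= k)%N.
Proof.
move=> wk dV; rewrite leqNgt; apply/negP => kd.
have := before_find 0%N kd.
by rewrite nth_iota ?add0n ?wk// (ltn_trans kd).
Qed.

Lemma gdist_le_diameter x y : (gdist e x y <= diameter e)%N.
Proof.
apply: leq_trans (leq_bigmax (F := fun x => \max_y gdist e x y) x).
exact: (leq_bigmax (F := gdist e x) y).
Qed.

Hypothesis e_graph : is_connected_graph e.

Lemma gdist_lt_card x y : (gdist e x y < #|V|)%N.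
Proof.
have /connectP[p ep yp] := graph_conn e_graph x y.
rewrite /gdist -[X in (_ < X)%N](size_iota 0 #|V|) -has_find; apply/hasP.
(* A path without repetition has at most [#|V|] vertices, hence fewer than [#|V|] edges, so the
   search defining [gdist] succeeds. *)
case/shortenP: ep yp => q eq uq _ yq.
exists (size q); last by apply/walkP; exists q.
by rewrite mem_iota add0n/=; apply: leq_trans (max_card (mem (x :: q)));
   rewrite (card_uniqP uq).
Qed.

Lemma walk_gdist x y : walk e (gdist e x y) x y.
Proof.
have := gdist_lt_card x y.
rewrite {1}/gdist -[X in (_ < X)%N](size_iota 0 #|V|) -has_find => /(nth_find 0%N).
by rewrite nth_iota ?gdist_lt_card.
Qed.

Lemma gdist_le k x y : walk e k x y -> (gdist e x y <= k)%N.
Proof. by move=> wk; exact: gdist_le_walk wk (gdist_lt_card x y). Qed.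

Lemma gdist_eq0 x y : (gdist e x y == 0)%N = (x == y).
Proof.
apply/eqP/eqP => [d0|->].
  by have := walk_gdist x y; rewrite d0 => /walkP[p [/size0nil-> _ <-]].
by apply/eqP; rewrite -leqn0; apply: gdist_le; apply/walkP; exists [::].
Qed.

Lemma gdist_leS x y z : e y z -> (gdist e x z <= (gdist e x y).+1)%N.
Proof.
move=> eyz; have /walkP[p [sp ep lp]] := walk_gdist x y.
apply: gdist_le; apply/walkP; exists (rcons p z).
by rewrite size_rcons sp rcons_path ep last_rcons lp.
Qed.

(** Drop the last vertex of a shortest walk; an edge raises the distance by at most one, so what
    remains is again shortest. *)
Lemma gdist_pred x y k : gdist e x y = k.+1 ->
  exists2 w, e w y & gdist e x w = k.
Proof.
move=> dk; have := walk_gdist x y; rewrite dk => /walkP[p].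
case/lastP: p => [[//]|p z]; rewrite size_rcons rcons_path last_rcons.
move=> [[sp] /andP[ep elz] zy]; rewrite zy in elz.
exists (last x p) => //; apply/eqP; rewrite eqn_leq gdist_le/=; last first.
  by apply/walkP; exists p.
by rewrite -ltnS -dk gdist_leS.
Qed.

End GraphDistance.

(** * The heat kernel as a function of the distance *)

Section DistanceRegular.
Variables (V : finType) (e : rel V) (d : nat) (bs cs : nat -> nat).
Hypothesis e_graph : is_connected_graph e.
Hypothesis drg : has_intersection_numbers e d bs cs.

(** The predecessor of [y] on a geodesic has [y] among the neighbours counted by [bs]. Positivity
    allows division by these numbers later. *)
Lemma intersection_b_gt0 x y k : gdist e x y = k.+1 -> (0 < bs k)%N.
Proof.
move=> dk; have [w ewy dw] := gdist_pred e_graph dk.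
rewrite -dw -(drg_b drg) card_gt0; apply/set0Pn; exists y.
by rewrite inE ewy dk dw eqxx.
Qed.

(** No vertex lies beyond the diameter, so the count is empty there. Truncation makes the vanishing
    of [bs] at the diameter an equation. *)
Lemma has_intersection_numbers_trunc : has_intersection_numbers e d
  (fun i => if (i < diameter e)%N then bs i else 0%N) cs.
Proof.
case: drg => reg hb hc; split=> // x y; case: ltnP => [_|dD]; first exact: hb.
apply/eqP; rewrite cards_eq0; apply/eqP/setP => z; rewrite !inE.
apply/negbTE; rewrite negb_and orbC; apply/orP; left.
by rewrite neq_ltn ltnS (leq_trans (gdist_le_diameter e x z) dD).
Qed.

Variable R : realType.
Implicit Types (f : nat -> R) (K : R).

(** The action of K - L on functions of the distance from a fixed vertex. At [i = 0] the first term
    vanishes because [0.-1] is [0]. *)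
Definition dist_op K f i : R :=
  (cs i)%:R * (f i.-1 - f i) + (bs i)%:R * (f i.+1 - f i) + K * f i.

Definition shifted_laplacian K : 'M[R]_#|V| := - laplacian R e + K%:M.

Lemma mulmx_shifted_laplacian (M : 'M[R]_#|V|) K i v :
  (M *m shifted_laplacian K) i (enum_rank v) =
  \sum_(z | e v z) (M i (enum_rank z) - M i (enum_rank v))
  + K * M i (enum_rank v).
Proof.
rewrite mulmxDr mul_mx_scalar mxE [X in _ + X]mxE; congr (_ + _).
rewrite /laplacian opprB mulmxBr mxE sumrB; congr (_ + _).
  rewrite mxE (reindex_onto enum_rank enum_val) => [|k _]; last exact: enum_valK.
  rewrite [RHS]big_mkcond; apply: eq_big => [z|z _].
    by rewrite enum_rankK eqxx.
  rewrite mxE !enum_rankK (graph_sym e_graph).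
  by case: ifP => _; rewrite ?mulr1 ?mulr0.
rewrite mxE; congr (- _).
rewrite /degmx mul_mx_diag !mxE enum_rankK mulr_natr sumr_const /degree.
by congr (_ *+ _); apply: eq_card => z; rewrite !inE.
Qed.

(** Neighbours of [v] lie at distance i - 1, i or i + 1 from [u]; those at distance i contribute
    zero. *)
Lemma sum_neighbors_gdist f u v :
  \sum_(z | e v z) (f (gdist e u z) - f (gdist e u v)) =
  (cs (gdist e u v))%:R * (f (gdist e u v).-1 - f (gdist e u v))
  + (bs (gdist e u v))%:R * (f (gdist e u v).+1 - f (gdist e u v)).
Proof.
set i := gdist e u v.
transitivity (\sum_(z | e v z)
    ((if ((gdist e u z).+1 == i)%N then f i.-1 - f i else 0)
    + (if (gdist e u z == i.+1)%N then f i.+1 - f i else 0))).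
  apply: eq_bigr => z evz.
  have zi : (gdist e u z <= i.+1)%N by exact: gdist_leS.
  have iz : (i <= (gdist e u z).+1)%N.
    by apply: gdist_leS => //; rewrite (graph_sym e_graph).
  case: (ltngtP (gdist e u z) i) => [zlt|zgt|->].
  - have <- : (gdist e u z).+1 = i by apply/eqP; rewrite eqn_leq zlt iz.
    by rewrite eqxx /= ltn_eqF// ?addr0// ltnS leqnSn.
  - have -> : gdist e u z = i.+1 by apply/eqP; rewrite eqn_leq zgt zi.
    by rewrite eqxx gtn_eqF ?add0r// ltnS leqnSn.
  - by rewrite gtn_eqF// ltn_eqF// subrr addr0.
rewrite big_split/= -!big_mkcondr !sumr_const !mulr_natl.
congr (_ *+ _ + _ *+ _).
  by rewrite -(drg_c drg); apply: eq_card => z; rewrite !inE.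
by rewrite -(drg_b drg); apply: eq_card => z; rewrite !inE.
Qed.

Lemma mulmx_dist_op (M : 'M[R]_#|V|) K f u :
  (forall z, M (enum_rank u) (enum_rank z) = f (gdist e u z)) ->
  forall v, (M *m shifted_laplacian K) (enum_rank u) (enum_rank v) =
    dist_op K f (gdist e u v).
Proof.
move=> Mf v; rewrite mulmx_shifted_laplacian /dist_op -sum_neighbors_gdist Mf.
by congr (_ + _); apply: eq_bigr => z _; rewrite Mf.
Qed.

Lemma mulmx_iter_dist_op (M : 'M[R]_#|V|) K f u k :
  (forall z, M (enum_rank u) (enum_rank z) = f (gdist e u z)) ->
  forall v, (M *m shifted_laplacian K ^+ k) (enum_rank u) (enum_rank v) =
    iter k (dist_op K) f (gdist e u v).
Proof.
move=> Mf; elim: k => [|k IHk] v; first by rewrite expr0 mulmx1.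
rewrite exprSr -mulmxE mulmxA iterS.
exact: mulmx_dist_op.
Qed.

Lemma shifted_laplacian_sym K : (shifted_laplacian K)^T = shifted_laplacian K.
Proof.
rewrite /shifted_laplacian linearD linearN/= tr_scalar_mx; congr (- _ + _).
rewrite /laplacian linearB/= /degmx tr_diag_mx; congr (_ - _).
by apply/matrixP => i j; rewrite !mxE (graph_sym e_graph).
Qed.

Definition dist_coef K k : nat -> R :=
  iter k (dist_op K) (fun i => (i == 0)%:R).

Lemma expr_shifted_laplacian K k u v :
  (shifted_laplacian K ^+ k) (enum_rank u) (enum_rank v) =
  dist_coef K k (gdist e u v).
Proof.
rewrite -[_ ^+ k]mul1mx; apply: mulmx_iter_dist_op => z.
by rewrite mxE (inj_eq enum_rank_inj) (gdist_eq0 e_graph).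
Qed.

(** Indexed by a number instead of a pair of vertices; its convergence is obtained at distances that
    occur, where it is a matrix entry. This is why later lemmas carry witnesses [u] and [v]. *)
Definition dist_heat K t i : R :=
  limn (pseries (fun k => dist_coef K k i / k`!%:R) t).

Lemma expmx_shifted_laplacian K t u v :
  expmx (t *: shifted_laplacian K) (enum_rank u) (enum_rank v) =
  dist_heat K t (gdist e u v).
Proof.
rewrite expmxE; congr (limn (pseries _ t)); apply/funext => k.
by rewrite /expmx_coef expr_shifted_laplacian.
Qed.

Lemma exp_moment_shifted_laplacian K t u k :
  exp_moment (shifted_laplacian K) (enum_rank u) k t =
  iter k (dist_op K) (dist_heat K t) 0%N.
Proof.
rewrite /exp_moment exprn_expmx_comm.
rewrite (mulmx_iter_dist_op _ _ (expmx_shifted_laplacian K t u)).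
by have /eqP -> : gdist e u u == 0%N by rewrite (gdist_eq0 e_graph).
Qed.

Lemma is_derive_dist_heat K t u v :
  is_derive t (1 : R) (fun t => dist_heat K t (gdist e u v))
    (dist_op K (dist_heat K t) (gdist e u v)).
Proof.
rewrite -(mulmx_dist_op _ (expmx_shifted_laplacian K t u)) -expmx_comm.
under eq_fun do rewrite -expmx_shifted_laplacian.
exact: is_derive_expmx.
Qed.

Lemma is_cvg_dist_coef K t u v :
  cvgn (pseries (fun k => dist_coef K k (gdist e u v) / k`!%:R) t).
Proof.
rewrite (_ : (fun _ => _) =
    expmx_coef (shifted_laplacian K) (enum_rank u) (enum_rank v)).
  exact: is_cvg_expmx_coef.
by apply/funext => k; rewrite /expmx_coef expr_shifted_laplacian.
Qed.

Lemma dist_heat_le K t u v w : 0 <= t ->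
  (forall k, dist_coef K k (gdist e u v) <= dist_coef K k (gdist e u w)) ->
  dist_heat K t (gdist e u v) <= dist_heat K t (gdist e u w).
Proof.
move=> t0 le_vw; apply: lim_series_le => [||k].
- exact: is_cvg_dist_coef.
- exact: is_cvg_dist_coef.
- by rewrite ler_wpM2r ?exprn_ge0// ler_wpM2r ?invr_ge0.
Qed.

Lemma dist_heat_ge_coef0 K t u v : 0 <= t ->
  (forall k, 0 <= dist_coef K k (gdist e u v)) ->
  dist_coef K 0 (gdist e u v) <= dist_heat K t (gdist e u v).
Proof.
move=> t0 c0.
(* The constant term is the partial sum of length one, and partial sums increase. *)
have <- : pseries (fun k => dist_coef K k (gdist e u v) / k`!%:R) t 1 =
    dist_coef K 0 (gdist e u v).
  by rewrite /pseries /series/= big_nat1 fact0 divr1 expr0 mulr1.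
apply: nondecreasing_cvgn_le; last exact: is_cvg_dist_coef.
apply: nondecreasing_series => k _ _.
by rewrite mulr_ge0 ?exprn_ge0// divr_ge0.
Qed.

End DistanceRegular.

(** * Diameter three: monotone profiles and Wronskians *)

Definition nonneg_nonincreasing4 (R : realType) (f : nat -> R) :=
  [/\ f 1%N <= f 0%N, f 2%N <= f 1%N, f 3%N <= f 2%N & 0 <= f 3%N].

Section DiameterThree.
Variables (R : realType) (V : finType) (e : rel V) (d : nat).
Variables (bs cs : nat -> nat).
Hypothesis e_graph : is_connected_graph e.
Hypothesis drg : has_intersection_numbers e d bs cs.
Hypothesis bs3 : bs 3%N = 0%N.

(* Large enough for [dist_op] to preserve nonnegative nonincreasing sequences. *)
Definition total_shift : R := (\sum_(i < 4) (bs i + cs i))%:R.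

Local Notation K := total_shift.
Local Notation T := (dist_op bs cs K).
Local Notation h := (dist_heat bs cs K).

(** With gaps g_i = f_i - f_(i+1), the new gap is c_i g_(i-1) + (K - b_i - c_(i+1)) g_i + b_(i+1)
    g_(i+1), where the c_0 term is absent; the choice of [K] makes every coefficient nonnegative.
    Since b_3 = 0, the value [f 4] never enters. *)
Lemma dist_op_nonneg_nonincreasing4 (f : nat -> R) :
  nonneg_nonincreasing4 f -> nonneg_nonincreasing4 (T f).
Proof.
rewrite /nonneg_nonincreasing4 /dist_op /K !big_ord_recl big_ord0 addn0 !natrD.
rewrite /= /bump /= bs3.
move: (bs 0%N)%:R (bs 1%N)%:R (bs 2%N)%:R (ler0n R (bs 0%N)) (ler0n R (bs 1%N))
  (ler0n R (bs 2%N)) => b0 b1 b2 ? ? ?.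
move: (cs 0%N)%:R (cs 1%N)%:R (cs 2%N)%:R (cs 3%N)%:R (ler0n R (cs 0%N))
  (ler0n R (cs 1%N)) (ler0n R (cs 2%N)) (ler0n R (cs 3%N)) => c0 c1 c2 c3 ? ? ? ?.
move: (f 0%N) (f 1%N) (f 2%N) (f 3%N) => f0 f1 f2 f3 [f01 f12 f23 f3_ge0].
by split; nra.
Qed.

Lemma dist_coef_nonneg_nonincreasing4 k :
  nonneg_nonincreasing4 (dist_coef bs cs K k).
Proof.
elim: k => [|k IHk]; first by split; rewrite ?ler01.
exact: dist_op_nonneg_nonincreasing4.
Qed.

Lemma dist_heat0_gt0 (u : V) t : 0 <= t -> 0 < h t 0%N.
Proof.
move=> t0; have duu : gdist e u u = 0%N.
  by apply/eqP; rewrite (gdist_eq0 e_graph).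
have := @dist_heat_ge_coef0 V e d bs cs e_graph drg R K t u u t0; rewrite duu.
move=> h1; apply: lt_le_trans (h1 _) => [|k]; first exact: ltr01.
have [f01 f12 f23 f3] := dist_coef_nonneg_nonincreasing4 k.
by rewrite (le_trans f3)// (le_trans f23)// (le_trans f12).
Qed.

Lemma dist_heatS_le u v t i : 0 <= t -> (i < 3)%N -> gdist e u v = i.+1 ->
  h t i.+1 <= h t i.
Proof.
move=> t0 i3 duv; have [w _ duw] := gdist_pred e_graph duv.
rewrite -duv -duw; apply: (dist_heat_le e_graph drg) => // k; rewrite duv duw.
have [f01 f12 f23 f3] := dist_coef_nonneg_nonincreasing4 k.
by case: i i3 {duv duw} => [|[|[|]]].
Qed.

Lemma dist_heat3_ge0 u v t : 0 <= t -> gdist e u v = 3%N -> 0 <= h t 3%N.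
Proof.
move=> t0 duv.
have := @dist_heat_ge_coef0 V e d bs cs e_graph drg R K t u v t0; rewrite duv.
move=> h1; apply: le_trans (h1 _) => // k.
by have [] := dist_coef_nonneg_nonincreasing4 k.
Qed.

Definition wronskian i t := T (h t) i * h t 0%N - h t i * T (h t) 0%N.

(** By the recurrence at 0, b_0 h_1 is h_0' plus a multiple of h_0, and that multiple cancels in the
    Wronskian. *)
Lemma wronskian1_ge0 u v t : gdist e u v = 1%N -> 0 <= wronskian 1 t.
Proof.
move=> duv.
have b0 : 0 < (bs 0%N)%:R :> R by rewrite ltr0n (intersection_b_gt0 e_graph drg duv).
have wE : (bs 0%N)%:R * wronskian 1 t =
    exp_moment (shifted_laplacian e K) (enum_rank u) 0 t
      * exp_moment (shifted_laplacian e K) (enum_rank u) 2 t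
    - exp_moment (shifted_laplacian e K) (enum_rank u) 1 t ^+ 2.
  rewrite !(exp_moment_shifted_laplacian e_graph drg) /wronskian.
  move: K (h t) => L f; rewrite /= /dist_op /=.
  by ring.
rewrite -(pmulr_rge0 _ b0) wE subr_ge0; apply: exp_moment_log_convex.
exact: shifted_laplacian_sym.
Qed.

Lemma wronskian2_ge0 u v t : 0 <= t -> gdist e u v = 2%N -> 0 <= wronskian 2 t.
Proof.
move=> t0 duv.
have [w ewv duw] := gdist_pred e_graph duv.
have b0 : 0 < (bs 0%N)%:R :> R by rewrite ltr0n (intersection_b_gt0 e_graph drg duw).
have b1 : 0 < (bs 1%N)%:R :> R by rewrite ltr0n (intersection_b_gt0 e_graph drg duv).
(* The sum of the diagonal coefficients of [T] at 0 and 1. Eliminating h_1 from the first two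
   recurrences gives b_0 b_1 h_2 = h_0'' - c h_0' plus a multiple of h_0. *)
pose c := (K - (bs 0%N)%:R) + (K - (cs 1%N)%:R - (bs 1%N)%:R).
have wE x : (bs 0%N)%:R * (bs 1%N)%:R * wronskian 2 x =
    exp_moment (shifted_laplacian e K) (enum_rank u) 3 x
      * exp_moment (shifted_laplacian e K) (enum_rank u) 0 x
    - exp_moment (shifted_laplacian e K) (enum_rank u) 2 x
      * exp_moment (shifted_laplacian e K) (enum_rank u) 1 x
    - c * (exp_moment (shifted_laplacian e K) (enum_rank u) 2 x
      * exp_moment (shifted_laplacian e K) (enum_rank u) 0 x
      - exp_moment (shifted_laplacian e K) (enum_rank u) 1 x ^+ 2).
  rewrite !(exp_moment_shifted_laplacian e_graph drg) /wronskian /c.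
  move: K (h x) => L f; rewrite /= /dist_op /=.
  by ring.
rewrite -(pmulr_rge0 _ (mulr_gt0 b0 b1)) wE.
apply: exp_moment_third_order => //; first exact: shifted_laplacian_sym.
(* At time 0 the profile is the indicator of distance 0, and one application of [T] does not reach
   distance 2. *)
rewrite -wE /wronskian /dist_op /= /dist_heat !lim_pseries0 /dist_coef/=.
by rewrite !mulr0n; ring.
Qed.

Lemma wronskian3_ge0 u v t : 0 <= t -> gdist e u v = 3%N -> 0 <= wronskian 3 t.
Proof.
move=> t0 duv; have [w _ duw] := gdist_pred e_graph duv.
have [z _ duz] := gdist_pred e_graph duw.
have := dist_heat3_ge0 t0 duv.
have := dist_heatS_le t0 (isT : (2 < 3)%N) duv.
have := dist_heatS_le t0 (isT : (1 < 3)%N) duw.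
have := dist_heatS_le t0 (isT : (0 < 3)%N) duz.
rewrite /wronskian /dist_op /= bs3.
move: K (h t 0%N) (h t 1%N) (h t 2%N) (h t 3%N) => L h0 h1 h2 h3 h10 h21 h32 h3_0.
(* The two terms in [K] cancel, leaving products of nonnegative factors. *)
rewrite mul0r addr0 (_ : _ - _ =
  (cs 3%N)%:R * (h2 - h3) * h0 + (bs 0%N)%:R * (h0 - h1) * h3); last by ring.
by rewrite addr_ge0// !mulr_ge0 ?ler0n ?subr_ge0//; lra.
Qed.

Lemma heat_ratioE u v t :
  heat_ratio e u v t = h t (gdist e u v) / h t 0%N.
Proof.
have expE w : heat_kernel e t u w =
    (expR (K * t))^-1 * h t (gdist e u w).
  rewrite -(expmx_shifted_laplacian e_graph drg) expmx_addscalar mxE mulKf ?gt_eqF ?expR_gt0//.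
  by rewrite /heat_kernel scaleNr scalerN.
have /eqP duu : gdist e u u == 0%N by rewrite (gdist_eq0 e_graph).
by rewrite /heat_ratio !expE duu -mulf_div divff ?mul1r// invr_eq0 gt_eqF ?expR_gt0.
Qed.

Lemma diameter3_MNHD : (diameter e <= 3)%N -> MNHD R e.
Proof.
move=> D3 u v uv s t; rewrite !in_itv/= !andbT => s0 _ st.
rewrite !heat_ratioE.
have /eqP duu : gdist e u u == 0%N by rewrite (gdist_eq0 e_graph).
apply: (@ratio_homo R (fun t => h t (gdist e u v)) (fun t => h t 0%N)
  (fun t => T (h t) (gdist e u v)) (fun t => T (h t) 0%N)) => // x x0.
- exact: (is_derive_dist_heat e_graph drg).
- by have := is_derive_dist_heat e_graph drg K x u u; rewrite duu.
- exact: (dist_heat0_gt0 u).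
rewrite -/(wronskian (gdist e u v) x).
have := leq_trans (gdist_le_diameter e u v) D3.
case duv: (gdist e u v) => [|[|[|[|//]]]] _.
- by move/eqP: duv; rewrite (gdist_eq0 e_graph) (negbTE uv).
- exact: wronskian1_ge0 duv.
- exact: wronskian2_ge0 duv.
- exact: wronskian3_ge0 duv.
Qed.

End DiameterThree.

Theorem theorem1 (R : realType) (V : finType) (e : rel V) (b alpha beta : R) :
  is_connected_graph e ->
  has_classical_parameters e 3 b alpha beta ->
  MNHD R e.
Proof.
move=> e_graph [D3 [d [bs [cs [drg _ _]]]]].
have drg' := has_intersection_numbers_trunc drg.
(* With diameter 3 the truncated [bs] evaluates to 0 at 3. *)
by apply: (diameter3_MNHD e_graph drg'); rewrite D3.
Qed.
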